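(* Let $x=(u,z)\in V$ be a solution of $$b(x,\varphi)=-\tfrac{1}{\sqrt{\alpha}}(u_d,I\varphi_1)_W\quad\text{for all }\varphi=(\varphi_1,\varphi_2)\in V,$$ and, for each $h$, let $\tilde x_h=(\tilde u_h,\tilde z_h)\in V_h$ be given by $$b_h(\tilde x_h,\varphi_h)=-\tfrac{1}{\sqrt{\alpha}}(u_d,I\varphi_{h,1})_W\quad\text{for all }\varphi_h=(\varphi_{h,1},\varphi_{h,2})\in V_h.$$ Assume: (i) there is $\bar\mu\ge1$ with $\mu_h\le\bar\mu$ for all $h$; (ii) $\lim_{h\to0}\inf_{v_h\in V_h}\|v-v_h\|=0$ for all $v\in V$; (iii) whenever $d_h\rightharpoonup0$ weakly in $V_2$ as $h\to0$, then $C_h^*d_h\to0$ strongly in $Q$ as $h\to0$; (iv) $I:V_1\to W$ is compact. If the exact solution $x$ satisfies $$\sup_{\varphi_h\in V_h\setminus\{0\}}\frac{\langle(C_hC_h^*-CC^* )z,\varphi_{h,2}\rangle_2}{\|\varphi_h\|_{\alpha,h}}=o\Big(\inf_{v_h\in V_h}\|x-v_h\|\Big)\quad\text{as }h\to0,$$ then $$\|x-\tilde x_h\|\le\mu_h\left(1+\frac{\tilde\kappa}{\sqrt{\alpha}}\,o(1)\right)\inf_{v_h\in V_h}\|x-v_h\|\quad\text{as }h\to0,$$ where $$\tilde\kappa=\frac{1+2\tilde L}{1+\tilde L}\left(1+\tilde M\bar\mu\left(1+\frac{2\tilde M}{\sqrt{\alpha}}\right)\right)<\infty,\qquad\tilde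 L=\frac{\tilde M}{\sqrt{\alpha}},\qquad\tilde M:=\sup_h\tilde M_h .$$
   Context: Let $Q, W, V_1, V_2$ be real Hilbert spaces with norms $\|\cdot\|_Q,\|\cdot\|_W,\|\cdot\|_1,\|\cdot\|_2$; $\langle\cdot,\cdot\rangle_i$ denotes the duality pairing of $V_i^*$ and $V_i$. Let $a:V_1\times V_2\to\mathbb{R}$ be a bounded bilinear form such that, for all $v_1\in V_1$, if $a(v_1,v_2)=0$ for all $v_2\in V_2$, then $v_1=0$, and $\inf_{\|v_2\|_2=1}\sup_{\|v_1\|_1=1}a(v_1,v_2)>0$. The norm of $V_2$ is (after replacing it, if necessary, by an equivalent one) $\|v_2\|_2=\sup_{\varphi_1\in V_1,\ \|\varphi_1\|_1=1}a(\varphi_1,v_2)$, so that the continuity and inf-sup constants of $a$ are both $1$. Let $C:Q\to V_2^*$ and $I:V_1\to W$ be bounded linear operators, $M_I$ the operator norm of $I$, and $C^*:V_2\to Q$ given by $(q,C^*v_2)_Q=\langle Cq,v_2\rangle_2$. Let $\alpha>0$, $u_d\in W$. Let $h$ range over a sequence of positive numbers tending to $0$. For each $h$, let $C_h^*:V_2\to Q$ be a bounded linear operator with operator norm $M_{C_h}$, $C_h:Q\to V_2^*$ given by $\langle C_hq,v_2\rangle_2=(q,C_h^*v_2)_Q$, and $\tilde M_h:=\max\{M_I,M_{C_h}\}$. Set $V:=V_1\times V_2$ with $\|v\|:=(\|v_1\|_1^2+\|v_2\|_2^2)^{1/2}$ and, for $v,\varphi\in V$, $$b(v,\varphi) :=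 a(v_1,\varphi_2)+a(\varphi_1,v_2)+\tfrac{1}{\sqrt{\alpha}}\big[(C^*v_2,C^*\varphi_2)_Q-(Iv_1,I\varphi_1)_W\big],$$ $$b_h(v,\varphi) := a(v_1,\varphi_2)+a(\varphi_1,v_2)+\tfrac{1}{\sqrt{\alpha}}\big[(C_h^*v_2,C_h^*\varphi_2)_Q-(Iv_1,I\varphi_1)_W\big],$$ $$\|\varphi\|_{\alpha,h}:=\|\varphi\|+\frac{\tilde M_h}{\sqrt{\alpha}}\big(\|I\varphi_1\|_W^2+\|C_h^*\varphi_2\|_Q^2\big)^{1/2}.$$ For each $h$, let $V_{h,i}\subset V_i$, $i=1,2$, be finite-dimensional subspaces such that the restriction of $a$ to $V_{h,1}\times V_{h,2}$ is nondegenerate (no nonzero element of either space is annihilated by the whole other space), and $V_h:=V_{h,1}\times V_{h,2}$. The generalized Ritz projection $R_{h,1}:V_1\to V_{h,1}$ is given by $a(R_{h,1}v_1,\varphi_{h,2})=a(v_1,\varphi_{h,2})$ for all $\varphi_{h,2}\in V_{h,2}$. The quasi-best-approximation constant $\mu_h$ of the constraint discretization is the smallest number $\mu_h\ge1$ such that $\|v_1-R_{h,1}v_1\|_1\le\mu_h\inf_{v_{h,1}\in V_{h,1}}\|v_1-v_{h,1}\|_1$ for all $v_1\in V_1$. Here $f_h=o(g_h)$ as $h\to0$ means $|f_h|\le\epsilon_hg_h$ with $\epsilon_h\to0$. *)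

(* Defs.v *)
From mathcomp Require Import all_boot all_order all_algebra.
From mathcomp Require Import all_classical all_reals all_analysis.
Import Order.TTheory GRing.Theory Num.Theory.
Import numFieldNormedType.Exports.

Set Implicit Arguments.
Unset Strict Implicit.
Unset Printing Implicit Defensive.

Local Open Scope classical_set_scope.
Local Open Scope ring_scope.

(* A Hilbert space is a complete normed module [V] together with an inner
   product [ip : {dot V for idfun}] inducing its norm. *)
Definition induces_norm (R : realType) (V : completeNormedModType R)
    (ip : {dot V for idfun}) : Prop :=
  forall v : V, ip v v = `|v| ^+ 2.

(* A bounded linear operator [C] from [U] to the dual of [V] is represented by
   the bounded bilinear form [C u v], to be read as the duality pairing
   <C u, v>. *)
Definition bounded_bilinear (R : realType) (U V : normedModType R)
    (f : U -> V -> R) : Prop :=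
  exists K : R, forall (u : U) (v : V), `|f u v| <= K * `|u| * `|v|.

Definition opnorm (R : realType) (U V : normedModType R) (f : U -> V) : R :=
  sup [set `|f u| | u in [set u : U | `|u| <= 1]].

Definition compact_operator (R : realType) (U V : normedModType R)
    (f : U -> V) : Prop :=
  precompact (f @` [set u : U | `|u| <= 1]).

(* The (possibly infinite) inf-sup constant
   inf_{|v2| = 1} sup_{|v1| = 1} a(v1, v2). *)
Definition inf_sup (R : realType) (V1 V2 : normedModType R)
    (a : V1 -> V2 -> R) : \bar R :=
  ereal_inf [set ereal_sup [set (a v1 v2)%:E | v1 in [set v1 : V1 | `|v1| = 1]]
            | v2 in [set v2 : V2 | `|v2| = 1]].

Definition weak_cvg0 (R : realType) (V : normedModType R)
    (d : nat -> V) : Prop :=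
  forall l : {scalar V}, continuous (l : V -> R) ->
    (fun n => l (d n)) @ \oo --> (0 : R).

Definition little_o (R : realType) (f g : nat -> R) : Prop :=
  exists2 eps : nat -> R, eps @ \oo --> (0 : R) &
    forall n, `|f n| <= eps n * g n.

Definition fin_dim_subspace (R : realType) (V : normedModType R)
    (A : set V) : Prop :=
  exists (m : nat) (e : 'I_m -> V),
    A = [set \sum_(i < m) c i *: e i | c in [set: 'I_m -> R]].

Definition nondegenerate_on (R : realType) (V1 V2 : normedModType R)
    (a : V1 -> V2 -> R) (A1 : set V1) (A2 : set V2) : Prop :=
  (forall v1, A1 v1 -> (forall v2, A2 v2 -> a v1 v2 = 0) -> v1 = 0) /\
  (forall v2, A2 v2 -> (forall v1, A1 v1 -> a v1 v2 = 0) -> v2 = 0).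

(* Distance from [v] to [A]: inf_{w in A} N(v - w). *)
Definition best_error (R : realType) (V : zmodType) (N : V -> R)
    (A : set V) (v : V) : R :=
  inf [set N (v - w) | w in A].

Definition is_ritz_projection (R : realType) (V1 V2 : normedModType R)
    (a : V1 -> V2 -> R) (A1 : set V1) (A2 : set V2) (P : V1 -> V1) : Prop :=
  forall v1, A1 (P v1) /\ forall phi2, A2 phi2 -> a (P v1) phi2 = a v1 phi2.

Definition quasi_best (R : realType) (V1 : normedModType R) (A1 : set V1)
    (P : V1 -> V1) (m : R) : Prop :=
  1 <= m /\
  forall v1, `|v1 - P v1| <= m * best_error (fun v : V1 => `|v|) A1 v1.

Definition is_quasi_best_constant (R : realType) (V1 : normedModType R)
    (A1 : set V1) (P : V1 -> V1) (mu : R) : Prop :=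
  quasi_best A1 P mu /\ forall m, quasi_best A1 P m -> mu <= m.

(* The norm |v| = (|v1|^2 + |v2|^2)^(1/2) of V = V1 x V2; the norm that the
   library puts on [V1 * V2] is the maximum norm. *)
Definition prod_norm (R : realType) (V1 V2 : normedModType R)
    (v : V1 * V2) : R :=
  Num.sqrt (`|v.1| ^+ 2 + `|v.2| ^+ 2).

(* The form b is [bform] with [Cs] = C^*; b_h is [bform] with [Cs] = C_h^*. *)
Definition bform (R : realType) (Q W V1 V2 : completeNormedModType R)
    (ipQ : {dot Q for idfun}) (ipW : {dot W for idfun})
    (a : V1 -> V2 -> R) (I : V1 -> W) (alpha : R) (Cs : V2 -> Q)
    (v phi : V1 * V2) : R :=
  a v.1 phi.2 + a phi.1 v.2 +
  (Num.sqrt alpha)^-1 * (ipQ (Cs v.2) (Cs phi.2) - ipW (I v.1) (I phi.1)).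

(* max {M_I, M_{C_h}} *)
Definition max_opnorm (R : realType) (Q W V1 V2 : normedModType R)
    (I : V1 -> W) (Chs : V2 -> Q) : R :=
  Num.max (opnorm I) (opnorm Chs).

(* The norm |phi|_{alpha,h} *)
Definition alpha_norm (R : realType) (Q W V1 V2 : normedModType R)
    (I : V1 -> W) (alpha : R) (Chs : V2 -> Q) (phi : V1 * V2) : R :=
  prod_norm phi +
  max_opnorm I Chs / Num.sqrt alpha *
    Num.sqrt (`|I phi.1| ^+ 2 + `|Chs phi.2| ^+ 2).

(* The operator C_h from Q to the dual of V2 whose adjoint is [Chs] = C_h^*,
   as the duality pairing <C_h q, v2> = (q, C_h^* v2)_Q. *)
Definition dual_pairing (R : realType) (Q V2 : completeNormedModType R)
    (ipQ : {dot Q for idfun}) (Chs : V2 -> Q) (q : Q) (v2 : V2) : R :=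
  ipQ q (Chs v2).

Definition consistency_error (R : realType)
    (Q W V1 V2 : completeNormedModType R) (ipQ : {dot Q for idfun})
    (C : Q -> V2 -> R) (Cs : V2 -> Q) (I : V1 -> W) (alpha : R)
    (Chs : V2 -> Q) (z : V2) (A : set (V1 * V2)) : R :=
  sup [set (dual_pairing ipQ Chs (Chs z) phi.2 - C (Cs z) phi.2)
             / alpha_norm I alpha Chs phi
      | phi in A `\ 0].

Definition kappa (R : realType) (alpha M mubar : R) : R :=
  let L := M / Num.sqrt alpha in
  (1 + 2 * L) / (1 + L) * (1 + M * mubar * (1 + 2 * M / Num.sqrt alpha)).

(* Main.v *)
(* Write x = (u, z), let R_h x be the pair of Ritz projections with respect to a,
   and d = x - R_h x.  The projection of V_2 is the a-adjoint of the one of V_1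
   and a is an isometric pairing, so both have the quasi-best-approximation
   constant mu_h and |d| <= mu_h inf |x - v_h|.  The difference
   e = R_h x - x~_h solves the discrete problem with data I d_1, C_h^* d_2 and
   the consistency error, and the discrete problem is uniformly stable: testing
   with (- e_1, e_2) controls I e_1 and C_h^* e_2, and the inf-sup conditions
   then control e.  By Galerkin orthogonality and density d_i / |d_i| tends to 0
   weakly (every functional on V_1 or V_2 is represented through a), so the
   compactness of I and assumption (iii) make the data o(1) |d|. *)
Require Import Defs.
From mathcomp Require Import all_boot all_order all_algebra.
From mathcomp Require Import all_classical all_reals all_analysis.
From mathcomp Require Import ring lra.
Import Order.TTheory GRing.Theory Num.Theory.
Import numFieldNormedType.Exports.

Set Implicit Arguments.
Unset Strict Implicit.
Unset Printing Implicit Defensive.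

Local Open Scope classical_set_scope.
Local Open Scope ring_scope.

(** * Inner products: Cauchy-Schwarz and Riesz representation *)

Section InnerProduct.
Context (R : realType) (V : completeNormedModType R) (ip : {dot V for idfun}).
Context (ipE : induces_norm ip).

Lemma dotC u v : ip u v = ip v u.
Proof. by rewrite hermC expr0 mul1r. Qed.

Lemma dotDl u v w : ip (u + v) w = ip u w + ip v w.
Proof. exact: linearDl. Qed.

Lemma dotZl t u w : ip (t *: u) w = t * ip u w.
Proof. exact: linearZl. Qed.

Lemma dotDr u v w : ip w (u + v) = ip w u + ip w v.
Proof. exact: linearDr. Qed.

Lemma dotZr t u w : ip w (t *: u) = t * ip w u.
Proof. by rewrite dotC dotZl dotC. Qed.

Lemma dotNr u w : ip w (- u) = - ip w u.
Proof. by rewrite -scaleN1r dotZr mulN1r. Qed.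

Lemma dotBl u v w : ip (u - v) w = ip u w - ip v w.
Proof. exact: linearBl. Qed.

Lemma sqr_normD u v : `|u + v| ^+ 2 = `|u| ^+ 2 + 2 * ip u v + `|v| ^+ 2.
Proof. by rewrite -!ipE dotDl !dotDr (dotC v u); ring. Qed.

Lemma sqr_normZ t (u : V) : `|t *: u| ^+ 2 = t ^+ 2 * `|u| ^+ 2.
Proof. by rewrite normrZ exprMn real_normK ?num_real. Qed.

Lemma cauchy_schwarz u v : `|ip u v| <= `|u| * `|v|.
Proof.
have [->|u0] := eqVneq u 0; first by rewrite linear0l normr0 normr0 mul0r.
have nu : 0 < `|u| by rewrite normr_gt0.
rewrite -ler_sqr ?nnegrE ?mulr_ge0// exprMn real_normK ?num_real//.
(* This vector is [|u|^2] times the component of [v] orthogonal to [u]. *)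
have : 0 <= `|(- ip u v) *: u + (`|u| ^+ 2) *: v| ^+ 2 by rewrite exprn_ge0.
rewrite sqr_normD !sqr_normZ dotZl dotZr => H.
have : 0 <= `|u| ^+ 2 * (`|u| ^+ 2 * `|v| ^+ 2 - ip u v ^+ 2) by nra.
by rewrite pmulr_rge0 ?exprn_gt0// subr_ge0.
Qed.

Lemma parallelogram (u v : V) :
  `|u - v| ^+ 2 = 2 * `|u| ^+ 2 + 2 * `|v| ^+ 2 - 4 * `|2^-1 *: (u + v)| ^+ 2.
Proof.
rewrite sqr_normZ !sqr_normD dotNr normrN.
by field.
Qed.

(** First-order condition at a minimiser. Evaluating at [t = - q / (p + 1)] gives
    [- q^2 (p + 2) / (p + 1)^2]; the shift by 1 covers [p = 0]. *)
Lemma ge0_quadratic_lin0 (p q : R) :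
  (forall t : R, 0 <= t ^+ 2 * p + 2 * t * q) -> 0 <= p -> q = 0.
Proof.
move=> H p0; have p1 : 0 < p + 1 by lra.
have := H (- q / (p + 1)).
have -> : (- q / (p + 1)) ^+ 2 * p + 2 * (- q / (p + 1)) * q =
  - (q ^+ 2 * ((p + 2) / (p + 1) ^+ 2)).
  by field; rewrite gt_eqF.
rewrite oppr_ge0 pmulr_lle0 ?divr_gt0 ?exprn_gt0//; last by lra.
by rewrite real_exprn_even_le0 ?num_real//= => /eqP.
Qed.

(* The representative minimises [v |-> |v|^2 - 2 l v]; by the parallelogram law
   every minimising sequence is Cauchy. *)
Lemma riesz (l : V -> R) (K : R) :
  (forall t u v, l (t *: u + v) = t * l u + l v) ->
  (forall v, `|l v| <= K * `|v|) ->
  exists r, forall v, l v = ip r v.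
Proof.
move=> lin lK.
have l0 : l 0 = 0 by have := lin 1 0 0; rewrite scaler0 addr0 mul1r; lra.
have lZ t u : l (t *: u) = t * l u by have := lin t u 0; rewrite l0 !addr0.
have lD u v : l (u + v) = l u + l v by have := lin 1 u v; rewrite scale1r mul1r.
have lN u : l (- u) = - l u by rewrite -scaleN1r lZ mulN1r.
pose J (v : V) := `|v| ^+ 2 - 2 * l v.
have Jlb v : - K ^+ 2 <= J v.
  have := lK v; rewrite ler_norml => /andP[_ lv].
  have := sqr_ge0 (`|v| - K); rewrite /J; nra.
pose m := inf (range J).
have hinf : has_inf (range J).
  by split; [exists (J 0), 0|exists (- K ^+ 2) => _ [v _ <-]].
have mJ v : m <= J v by apply: ge_inf; [exact: hinf.2|exists v].
(* The linear parts cancel in [2 J u + 2 J v - 4 J ((u + v) / 2)], and [J] is at least [m] at the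
   midpoint. *)
have par u v : `|u - v| ^+ 2 <= 2 * (J u - m) + 2 * (J v - m).
  rewrite parallelogram; have := mJ (2^-1 *: (u + v)).
  rewrite /J lZ lD; lra.
have /choice[f fP] (n : nat) : exists v, J v < m + n.+1%:R^-1.
  have n0 : 0 < n.+1%:R^-1 :> R by rewrite invr_gt0.
  by have [_ [v _ <-] ?] := inf_adherent n0 hinf; exists v.
have : cvg (f @ \oo).
  apply/cauchy_cvgP/cauchy_exP => e e0.
  (* Two gaps to [m], each below [e^2 / 4] and doubled in [par], add up to less than [e^2]. *)
  have e4 : 0 < e ^+ 2 / 4 by rewrite divr_gt0 ?exprn_gt0.
  have [N _ NP] := near_infty_natSinv_lt (PosNum e4).
  exists (f N); exists N => // n /= Nn; rewrite -ball_normE /=.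
  rewrite -ltr_sqr ?nnegrE ?(ltW e0)//.
  have := par (f N) (f n); have := fP N; have := fP n.
  have /= := NP N (leqnn N); have /= := NP n Nn.
  move: (N.+1%:R^-1) (n.+1%:R^-1) (e ^+ 2) (J (f n)) (J (f N)).
  by move: (`|f N - f n| ^+ 2) => c1 c2 c3 c4 c5 c6; lra.
move=> /cvg_ex[r fr].
have fr' : Num.norm \o f @ \oo --> `|r| by apply: cvg_norm.
have lr : l \o f @ \oo --> l r.
  apply/cvgrPdist_lt => e e0.
  have K1 : 0 < `|K| + 1 by rewrite ltr_wpDl.
  have /cvgrPdist_lt/(_ (e / (`|K| + 1))) := fr.
  rewrite divr_gt0// => /(_ isT); apply: filterS => n.
  rewrite ltr_pdivlMr// => H; rewrite /= -lN -lD.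
  apply: le_lt_trans (lK _) (le_lt_trans _ H); rewrite mulrC ler_wpM2l//.
  by rewrite (le_trans (ler_norm _))// lerDl.
have Jr : J r <= m.
  have Jf : J \o f @ \oo --> J r.
    apply: cvgB; last by apply: cvgM; [exact: cvg_cst|].
    by rewrite expr2; under eq_fun do rewrite expr2; apply: cvgM.
  have mf : (fun n => m + n.+1%:R^-1) @ \oo --> m + 0.
    by apply: cvgD; [exact: cvg_cst|exact: cvg_harmonic].
  rewrite -[m]addr0; apply: (ler_cvg_to Jf mf).
  by apply: nearW => n; rewrite ltW//; exact: fP.
exists r => v; apply/eqP; rewrite -subr_eq0 -oppr_eq0 opprB; apply/eqP.
(* [J (t v + r) - J r = t^2 |v|^2 + 2 t ((r, v) - l v)] is nonnegative for all [t]. *)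
apply: (@ge0_quadratic_lin0 (`|v| ^+ 2)) => // t.
have := le_trans Jr (mJ (t *: v + r)).
rewrite /J lin sqr_normD sqr_normZ dotZl (dotC v r); lra.
Qed.
End InnerProduct.

(** * Representation of functionals through the isometric pairing [a] *)

Section Pairing.
Context (R : realType) (V1 V2 : completeNormedModType R).
Context (ip1 : {dot V1 for idfun}) (ip1E : induces_norm ip1).
Context (ip2 : {dot V2 for idfun}) (ip2E : induces_norm ip2).
Context (a : {bilinear V1 -> V2 -> R | *%R & *%R}).
Context (a_bounded : bounded_bilinear a).
Context (a_nondeg : forall v1 : V1, (forall v2 : V2, a v1 v2 = 0) -> v1 = 0).
Context (norm2E : forall v2 : V2,
  `|v2| = sup [set a phi1 v2 | phi1 in [set phi1 : V1 | `|phi1| = 1]]).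

Lemma pairingZl t u v : a (t *: u) v = t * a u v.
Proof. exact: linearZl. Qed.

Lemma pairingZr t u v : a u (t *: v) = t * a u v.
Proof. exact: linearZr. Qed.

Lemma pairing_le u v : a u v <= `|u| * `|v|.
Proof.
have [->|u0] := eqVneq u 0; first by rewrite linear0l normr0 mul0r.
have nu : 0 < `|u| by rewrite normr_gt0.
rewrite mulrC -ler_pdivrMr// mulrC -pairingZl norm2E.
apply: ub_le_sup; last first.
  exists (`|u|^-1 *: u) => //=.
  by rewrite normrZ normfV normr_id mulVf// normr_eq0.
have [K aK] := a_bounded; exists (K * `|v|) => _ [w /= w1 <-].
by have := aK w v; rewrite w1 mulr1; apply: le_trans; rewrite ler_norm.
Qed.

Lemma norm_pairing_le u v : `|a u v| <= `|u| * `|v|.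
Proof.
rewrite ler_norml pairing_le andbT lerNl.
by have := pairing_le (- u) v; rewrite linearNl normrN.
Qed.

Lemma norm2_le (v2 : V2) (b : R) : 0 <= b ->
  (forall phi : V1, `|phi| = 1 -> a phi v2 <= b) -> `|v2| <= b.
Proof.
move=> b0 ab; rewrite norm2E.
(* If [V1] has no unit vector, the supremum is over the empty set and equals 0 by convention; hence
   the assumption [0 <= b]. *)
have [->|/set0P S0] :=
  eqVneq [set a phi v2 | phi in [set phi : V1 | `|phi| = 1]] set0.
  by rewrite sup0.
by apply: ge_sup => // _ [phi /= phi1 <-]; exact: ab.
Qed.

Lemma riesz_map :
  exists T : V2 -> V1, forall v2 phi1, a phi1 v2 = ip1 (T v2) phi1.
Proof.
suff /choice[T TE] : forall v2, exists r, forall phi1, a phi1 v2 = ip1 r phi1.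
  by exists T.
move=> v2; apply: (riesz ip1E (K := `|v2|)).
  by move=> t u v; rewrite linearDl pairingZl.
by move=> v; rewrite mulrC norm_pairing_le.
Qed.

(* [T] preserves the norm because the inf-sup and continuity constants of [a]
   are both 1, hence the inner product by polarization. *)
Lemma riesz_map_isometry (T : V2 -> V1) :
  (forall v2 phi1, a phi1 v2 = ip1 (T v2) phi1) ->
  (forall v, `|T v| = `|v|) /\ forall u v, ip1 (T u) (T v) = ip2 u v.
Proof.
move=> TE.
have nT v : `|T v| = `|v|.
  apply/eqP; rewrite eq_le; apply/andP; split.
    have [->|Tv0] := eqVneq (T v) 0; first by rewrite normr0.
    have nTv : 0 < `|T v| by rewrite normr_gt0.
    by rewrite -(ler_pM2l nTv) -expr2 -ip1E -TE pairing_le.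
  apply: norm2_le => // phi phi1; rewrite TE.
  rewrite (le_trans (ler_norm _))// (le_trans (cauchy_schwarz ip1E _ _))//.
  by rewrite phi1 mulr1.
split=> // u v.
have TD : T (u + v) = T u + T v.
  have wE phi : ip1 (T (u + v) - (T u + T v)) phi = 0.
    rewrite -[- (T u + T v)]scaleN1r dotDl dotZl dotDl -!TE linearDr /=; lra.
  by apply/eqP; rewrite -subr_eq0 -normr_eq0 -sqrf_eq0 -ip1E wE.
have := nT (u + v); rewrite TD => /(congr1 (fun x => x ^+ 2)).
rewrite (sqr_normD ip1E) (sqr_normD ip2E) !nT.
by move=> H; lra.
Qed.

(** This is the surjectivity of the isometry [T]. If [r] represents [a s] on [V2], then
    [a (T r) v = (T v, T r) = (v, r) = a s v] for all [v], and nondegeneracy gives [s = T r]. *)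
Lemma pairing_rep_l (s : V1) :
  exists2 r : V2, (forall phi, ip1 s phi = a phi r) & `|r| = `|s|.
Proof.
have [T TE] := riesz_map; have [nT ipT] := riesz_map_isometry TE.
have [r rE] : exists r, forall v, a s v = ip2 r v.
  apply: (riesz ip2E (K := `|s|)) => [t u v|v]; last exact: norm_pairing_le.
  by rewrite linearDr pairingZr.
suff sT : s = T r by exists r; rewrite ?sT ?nT// => phi; rewrite TE.
apply/eqP; rewrite -subr_eq0; apply/eqP; apply: a_nondeg => v.
by rewrite linearBl /= rE (TE v (T r)) (dotC _ (T v)) ipT subrr.
Qed.

Lemma pairing_rep_r (r : V2) : exists s : V1, forall v, ip2 r v = a s v.
Proof.
have [T TE] := riesz_map; have [nT ipT] := riesz_map_isometry TE.
by exists (T r) => v; rewrite TE dotC ipT.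
Qed.

End Pairing.

(** The coefficients of [w] solve a linear system with matrix [B]. Each column of [cokermx B] gives
    an element of [A1] annihilated by [A2], hence zero, so [b] also kills the cokernel and is in the
    row space. The families [e] and [f] only span, so no dimension count is made. *)
Lemma ex_ritz_projection_r (R : realType) (V1 V2 : normedModType R)
    (a : {bilinear V1 -> V2 -> R | *%R & *%R}) (A1 : set V1) (A2 : set V2)
    (z : V2) :
  fin_dim_subspace A1 -> fin_dim_subspace A2 ->
  (forall v1, A1 v1 -> (forall v2, A2 v2 -> a v1 v2 = 0) -> v1 = 0) ->
  exists2 w, A2 w & forall phi1, A1 phi1 -> a phi1 w = a phi1 z.
Proof.
move=> [m [e ->]] [k [f ->]] nd.
pose B : 'M[R]_(k, m) := \matrix_(j, i) a (e i) (f j).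
pose b : 'rV[R]_m := \row_i a (e i) z.
have suml (c : 'I_m -> R) v : a (\sum_i c i *: e i) v = \sum_i c i * a (e i) v.
  by rewrite linear_sumlz; apply: eq_bigr => i _; rewrite linearZl_LR.
have sumr (c : 'I_k -> R) u : a u (\sum_j c j *: f j) = \sum_j c j * a u (f j).
  by rewrite linear_sumr; apply: eq_bigr => i _; rewrite linearZr_LR.
have : (b <= B)%MS.
  rewrite submxE; apply/eqP/rowP => l; rewrite !mxE.
  have /nd : [set \sum_i c i *: e i | c in [set: 'I_m -> R]]
     (\sum_i cokermx B i l *: e i) by exists (cokermx B ^~ l).
  have H : forall v2, [set \sum_j c j *: f j | c in [set: 'I_k -> R]] v2 ->
      a (\sum_i cokermx B i l *: e i) v2 = 0.
    move=> _ [c _ <-]; rewrite sumr big1// => j _.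
    have /matrixP/(_ j l) := mulmx_coker B; rewrite !mxE suml => E.
    rewrite (_ : \sum_i _ = 0) ?mulr0// -[RHS]E.
    by apply: eq_bigr => i _; rewrite !mxE mulrC.
  move=> /(_ H) v0; have := suml (cokermx B ^~ l) z.
  rewrite v0 linear0l => sum0; rewrite [RHS]sum0.
  by apply: eq_bigr => i _; rewrite !mxE mulrC.
move=> /submxP[D /rowP bE].
exists (\sum_j D 0 j *: f j); first by exists (D 0).
move=> _ [c _ <-]; rewrite !suml; apply: eq_bigr => i _; congr (_ * _).
have := bE i; rewrite !mxE => ->; rewrite sumr.
by apply: eq_bigr => j _; rewrite !mxE.
Qed.

(** * Operator norms, uniform boundedness and compactness *)

Section Opnorm.
Context (R : realType) (U V : normedModType R) (f : {linear U -> V}).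

Lemma opnorm_has_sup : continuous f ->
  has_sup [set `|f u| | u in [set u : U | `|u| <= 1]].
Proof.
move=> /linear_bounded_continuous/linear_boundedP[K [_ KP]].
split; first by exists `|f 0|, 0; rewrite /= ?normr0.
exists (`|K| + 1) => _ [u /= u1 <-].
have := KP (`|K| + 1); rewrite ltr_pwDr ?ler_norm// => /(_ isT u).
by move/le_trans; apply; rewrite ler_piMr.
Qed.

Lemma opnorm_ge0 : continuous f -> 0 <= opnorm f.
Proof.
move=> /opnorm_has_sup[_ fs]; apply: ub_le_sup => //.
by exists 0; rewrite /= ?linear0 ?normr0.
Qed.

Lemma opnorm_le u : continuous f -> `|f u| <= opnorm f * `|u|.
Proof.
move=> /opnorm_has_sup[_ fs].
have [->|u0] := eqVneq u 0; first by rewrite linear0 !normr0 mulr0.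
have nu : 0 < `|u| by rewrite normr_gt0.
rewrite -ler_pdivrMr//; apply: ub_le_sup => //.
exists (`|u|^-1 *: u); last first.
  by rewrite linearZ normrZ normfV normr_id mulrC.
by rewrite /= normrZ normfV normr_id mulVf ?normr_eq0.
Qed.

Lemma opnorm_adherent : continuous f -> 0 < opnorm f ->
  exists2 u, `|u| <= 1 & opnorm f / 2 < `|f u|.
Proof.
move=> fc f0; have f2 : 0 < opnorm f / 2 by rewrite divr_gt0.
have [_ [u u1 <-] H] := sup_adherent f2 (opnorm_has_sup fc).
exists u => //; apply: le_lt_trans H; rewrite -/(opnorm f); lra.
Qed.

End Opnorm.

(* Divide a near-maximiser of [f n] by the running maximum of the operator
   norms: were these unbounded, the quotients would tend to [0], but [f n] maps
   them to elements of norm at least [1/2] whenever [opnorm (f n)] is a new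
   record. *)
Lemma opnorm_bounded (R : realType) (U V : normedModType R)
    (f : nat -> {linear U -> V}) :
  (forall n, continuous (f n)) ->
  (forall d : nat -> U, d @ \oo --> (0 : U) ->
    (fun n => f n (d n)) @ \oo --> (0 : V)) ->
  exists B, forall n, opnorm (f n) <= B.
Proof.
move=> fc fd; apply: contrapT => /forallNP unb.
have big A : exists n, A < opnorm (f n).
  apply: contrapT => /forallNP H; apply: (unb A) => n.
  by rewrite leNgt; apply/negP/H.
have /choice[v vP] n : exists u, `|u| <= 1 /\
    (0 < opnorm (f n) -> opnorm (f n) / 2 < `|f n u|).
  have [f0|] := boolP (0 < opnorm (f n)); last by exists 0; rewrite normr0.
  by have [u] := opnorm_adherent (fc n) f0; exists u.
(* Starting the maximum at 1 keeps [S n] positive. *)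
pose S n := \big[Num.max/1]_(k < n.+1) opnorm (f k).
have S_ge1 n : 1 <= S n by exact: bigmax_ge_id.
have S_ge n k : (k <= n)%N -> opnorm (f k) <= S n.
  by rewrite -ltnS => kn; exact: (le_bigmax _ _ (Ordinal kn)).
have S_gt0 n : 0 < S n by rewrite (lt_le_trans _ (S_ge1 n)).
pose d n := (S n)^-1 *: v n.
have dE n : `|d n| <= (S n)^-1.
  rewrite normrZ gtr0_norm ?invr_gt0//.
  by apply: ler_piMr; [rewrite invr_ge0 ltW|exact: (vP n).1].
have d0 : d @ \oo --> 0.
  apply/cvgr0Pnorm_lt => e e0; have [k kA] := big e^-1.
  exists k => // n /= kn; apply: le_lt_trans (dE n) _.
  by rewrite invf_plt ?posrE// (lt_le_trans kA)// S_ge.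
have /cvgr0Pnorm_lt/(_ (2^-1)) := fd _ d0.
rewrite invr_gt0 ltr0n => /(_ isT)[N _ NP].
(* The first [n] whose operator norm exceeds [S N] lies beyond [N] and is a record: all earlier
   norms are at most [S N]. *)
have [n nS nmin] := ex_minnP (big (S N)).
have Nn : (N <= n)%N.
  by rewrite leqNgt; apply/negP => /ltnW/S_ge; rewrite leNgt nS.
have Sn : S n <= opnorm (f n).
  apply/bigmax_leP; split; first by rewrite (le_trans (S_ge1 N))// ltW.
  move=> [k /= kn] _; have [kn'|] := ltnP k n; last first.
    by move=> nk; have -> : k = n by apply/eqP; rewrite eqn_leq nk andbT -ltnS.
  apply: (@le_trans _ _ (S N)); last exact: ltW.
  rewrite leNgt; apply/negP => /nmin.
  by rewrite leqNgt kn'.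
have fn0 : 0 < opnorm (f n) by exact: lt_le_trans Sn.
have := NP n Nn; rewrite /= linearZ normrZ gtr0_norm ?invr_gt0// => H.
have := (vP n).2 fn0; rewrite ltNge => /negP; apply.
rewrite ltW// (lt_le_trans (y := S n / 2))//; last by rewrite ler_pM2r.
by rewrite mulrC in H; rewrite -ltr_pdivrMl// mulrC.
Qed.

(* A nonzero cluster point [p] is excluded by the functional [(p, .)]. *)
Lemma compact_operator_cvg0 (R : realType) (V : normedModType R)
    (W : completeNormedModType R) (ipW : {dot W for idfun})
    (I : {linear V -> W}) (w : nat -> V) :
  induces_norm ipW -> compact_operator I -> (forall n, `|w n| <= 1) ->
  (forall y, (fun n => ipW y (I (w n))) @ \oo --> (0 : R)) ->
  (fun n => I (w n)) @ \oo --> (0 : W).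
Proof.
move=> ipWE; rewrite /compact_operator precompactE => Ic w1 weak.
apply/cvgr0Pnorm_lt => e e0.
(* Each point [p] of the compact closure gets a neighbourhood and a tail of indices where this
   implication holds; compactness makes the tail uniform. *)
have H : \forall n \near \oo, closure (I @` [set u : V | `|u| <= 1]) `<=`
    [set y | y = I (w n) -> `|y| < e].
  move/compact_near_coveringP : Ic; apply => p _.
  have [->|p0] := eqVneq p 0.
    have : \forall y \near (0 : W), `|y| < e.
      apply/nbhs_normP; exists e => // y; rewrite /= sub0r normrN//.
    by move=> y0; near=> y n => /= _; near: y.
  have np : 0 < `|p| by rewrite normr_gt0.
  have He : 0 < `|p| / 2 by rewrite divr_gt0.
  have A : \forall y \near p, `|p - y| < `|p| / 2.
    by apply/nbhs_normP; exists (`|p| / 2).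
  have B : \forall n \near \oo, `|ipW p (I (w n))| < `|p| * (`|p| / 2).
    by move/cvgr0Pnorm_lt : (weak p); apply; rewrite mulr_gt0.
  near=> y n => /= yE.
  have : ipW p y < `|p| * (`|p| / 2).
    by rewrite yE (le_lt_trans (ler_norm _))//; near: n.
  have : `|p - y| < `|p| / 2 by near: y.
  rewrite -(ltr_pM2l np) => H1.
  (* Near [p], [(p, y) = |p|^2 - (p, p - y) > |p|^2 / 2], against the bound from weak
     convergence. *)
  have := le_trans (ler_norm _) (cauchy_schwarz ipWE p (p - y)).
  rewrite dotDr dotNr ipWE; nra.
apply: filterS H => n Hn; apply: (Hn (I (w n))) => //.
by apply: subset_closure; exists (w n) => //=; exact: w1.
Unshelve. all: by end_near. Qed.

(** * Product norm, best errors and finite-dimensional subspaces *)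

Lemma sqrt_sqrD_triangle (R : realType) (a b c d : R) :
  Num.sqrt ((a + c) ^+ 2 + (b + d) ^+ 2) <=
  Num.sqrt (a ^+ 2 + b ^+ 2) + Num.sqrt (c ^+ 2 + d ^+ 2).
Proof.
have ge0 (s t : R) : 0 <= s ^+ 2 + t ^+ 2 by rewrite addr_ge0 ?sqr_ge0.
rewrite -ler_sqr ?nnegrE ?addr_ge0 ?sqrtr_ge0// sqr_sqrtr//.
rewrite [leRHS]sqrrD !sqr_sqrtr// -sqrtrM//; set p := Num.sqrt _.
suff : a * c + b * d <= p by rewrite mulr2n; lra.
rewrite (le_trans (ler_norm _))// -sqrtr_sqr ler_sqrt ?mulr_ge0//.
rewrite -subr_ge0 (_ : _ - _ = (a * d - b * c) ^+ 2) ?sqr_ge0//; ring.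
Qed.

Section ProdNorm.
Context (R : realType) (V1 V2 : normedModType R).
Implicit Types v w : V1 * V2.

Lemma ler_prod_normD v w : prod_norm (v + w) <= prod_norm v + prod_norm w.
Proof.
apply: le_trans (sqrt_sqrD_triangle _ _ _ _).
by rewrite ler_wsqrtr// lerD// lerXn2r ?nnegrE ?addr_ge0 ?ler_normD.
Qed.

Lemma prod_norm_ge1 v : `|v.1| <= prod_norm v.
Proof. by rewrite -[leLHS]normr_id -sqrtr_sqr ler_wsqrtr// lerDl sqr_ge0. Qed.

Lemma prod_norm_ge2 v : `|v.2| <= prod_norm v.
Proof. by rewrite -[leLHS]normr_id -sqrtr_sqr ler_wsqrtr// lerDr sqr_ge0. Qed.

Lemma sqrtr_sqrD_le (s t : R) : 0 <= s -> 0 <= t ->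
  Num.sqrt (s ^+ 2 + t ^+ 2) <= s + t.
Proof.
move=> s0 t0; rewrite -[leRHS]ger0_norm ?addr_ge0// -sqrtr_sqr ler_wsqrtr//.
by rewrite sqrrD; have := mulr_ge0 s0 t0; rewrite mulr2n; lra.
Qed.

Lemma prod_norm_le v : prod_norm v <= `|v.1| + `|v.2|.
Proof. exact: sqrtr_sqrD_le. Qed.

Lemma prod_norm_ge0 v : 0 <= prod_norm v.
Proof. exact: sqrtr_ge0. Qed.

End ProdNorm.

Lemma best_error_le (R : realType) (V : zmodType) (N : V -> R) (A : set V)
    (v w : V) :
  (forall u, 0 <= N u) -> A w -> best_error N A v <= N (v - w).
Proof.
move=> N0 Aw; apply: ge_inf; last by exists w.
by exists 0 => _ [u _ <-].
Qed.

Lemma best_error_ge (R : realType) (V : zmodType) (N : V -> R) (A : set V)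
    (v : V) (b : R) :
  A !=set0 -> (forall w, A w -> b <= N (v - w)) -> b <= best_error N A v.
Proof.
move=> [w Aw] Nb; apply: lb_le_inf; first by exists (N (v - w)), w.
by move=> _ [u Au <-]; exact: Nb.
Qed.

Lemma fin_dim_subspace0 (R : realType) (V : normedModType R) (A : set V) :
  fin_dim_subspace A -> A 0.
Proof.
move=> [m [e ->]]; exists (fun=> 0) => //.
by rewrite big1// => i _; rewrite scale0r.
Qed.

Lemma fin_dim_subspaceP (R : realType) (V : normedModType R) (A : set V) t u v :
  fin_dim_subspace A -> A u -> A v -> A (t *: u + v).
Proof.
move=> [m [e ->]] [c _ <-] [c' _ <-]; exists (fun i => t * c i + c' i) => //.
rewrite scaler_sumr -big_split; apply: eq_bigr => i _.
by rewrite scalerA scalerDl.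
Qed.

Lemma fin_dim_subspaceN (R : realType) (V : normedModType R) (A : set V) u :
  fin_dim_subspace A -> A u -> A (- u).
Proof.
move=> fA Au; rewrite -scaleN1r -[_ *: _]addr0.
by apply: fin_dim_subspaceP => //; exact: fin_dim_subspace0.
Qed.

Lemma fin_dim_subspaceB (R : realType) (V : normedModType R) (A : set V) u v :
  fin_dim_subspace A -> A u -> A v -> A (u - v).
Proof.
move=> fA Au Av; rewrite -[u]scale1r.
by apply: fin_dim_subspaceP => //; exact: fin_dim_subspaceN.
Qed.

(** * Adjoint projection and stability of the discrete problem *)

Section Discrete.
Context (R : realType) (V1 V2 : completeNormedModType R).
Context (ip1 : {dot V1 for idfun}) (ip1E : induces_norm ip1).
Context (ip2 : {dot V2 for idfun}) (ip2E : induces_norm ip2).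
Context (a : {bilinear V1 -> V2 -> R | *%R & *%R}).
Context (a_bounded : bounded_bilinear a).
Context (a_nondeg : forall v1 : V1, (forall v2 : V2, a v1 v2 = 0) -> v1 = 0).
Context (norm2E : forall v2 : V2,
  `|v2| = sup [set a phi1 v2 | phi1 in [set phi1 : V1 | `|phi1| = 1]]).
Context (A1 : set V1) (A2 : set V2).
Context (A1_fin : fin_dim_subspace A1) (A2_fin : fin_dim_subspace A2).

(* The projection onto [A2] is the adjoint of the one onto [A1] with respect to
   [a], so it inherits the constant [mu]. *)
Lemma quasi_best_adjoint (P : V1 -> V1) (mu : R) (z w v : V2) :
  is_ritz_projection a A1 A2 P -> quasi_best A1 P mu ->
  A2 w -> (forall phi, A1 phi -> a phi w = a phi z) -> A2 v ->
  `|z - w| <= mu * `|z - v|.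
Proof.
move=> ritzP [mu1 qP] Aw wE Av; have mu0 : 0 <= mu by lra.
apply: (norm2_le norm2E) => [|phi phi1]; first by rewrite mulr_ge0.
have [AP PE] := ritzP phi.
(* [P phi] may be subtracted because [z - w] is annihilated by [A1]; then [w] may become [v] because
   [phi - P phi] is annihilated by [A2]. *)
have -> : a phi (z - w) = a (phi - P phi) (z - v).
  by rewrite linearBl !linearBr /= -(PE w)// -(PE v)// wE//; ring.
apply: le_trans (pairing_le a_bounded norm2E _ _) _.
rewrite ler_wpM2r// (le_trans (qP phi))// -[leRHS]mulr1 ler_wpM2l//.
rewrite -phi1 -[X in _ <= `|X|]subr0.
by apply: best_error_le => //; exact: fin_dim_subspace0.
Qed.

Context (Q W : completeNormedModType R).
Context (ipQ : {dot Q for idfun}) (ipQE : induces_norm ipQ).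
Context (ipW : {dot W for idfun}) (ipWE : induces_norm ipW).
Context (I : {linear V1 -> W}) (D : {linear V2 -> Q}).
Context (M b m : R) (b_gt0 : 0 < b) (m_ge0 : 0 <= m) (M_ge0 : 0 <= M).
Context (IM : forall v, `|I v| <= M * `|v|) (DM : forall v, `|D v| <= M * `|v|).
(** The discrete inf-sup conditions in the form of Fortin operators: bounded maps into the discrete
    spaces that preserve the pairing. *)
Context (proj1 : forall phi, exists phih, [/\ A1 phih, `|phih| <= m * `|phi| &
  forall psi, A2 psi -> a phih psi = a phi psi]).
Context (proj2 : forall psi, exists psih, [/\ A2 psih, `|psih| <= m * `|psi| &
  forall phi, A1 phi -> a phi psih = a phi psi]).

(* Testing with [(- e.1, e.2)] makes the coupling terms cancel and controls
   [I e.1] and [D e.2]; the discrete inf-sup conditions do the rest. *)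
Lemma discrete_stability (e : V1 * V2) (q : Q) (w : W) (g : V2 -> R)
    (eta : R) (c := b * m * (M + 2)) :
  A1 e.1 -> A2 e.2 -> 0 <= eta ->
  (forall phi1 phi2, A1 phi1 -> A2 phi2 ->
     `|g phi2| <= eta * (`|phi1| + `|phi2|)) ->
  (forall phi1 phi2, A1 phi1 -> A2 phi2 ->
     a e.1 phi2 + a phi1 e.2 +
       b * (ipQ (D e.2) (D phi2) - ipW (I e.1) (I phi1))
     = b * (ipQ q (D phi2) - ipW w (I phi1) + g phi2)) ->
  `|e.1| + `|e.2| <= 4 * c * (1 + c) * (`|q| + `|w| + eta).
Proof.
case: e => e1 e2 /= Ae1 Ae2 eta0 gle eq.
have A10 := fin_dim_subspace0 A1_fin; have A20 := fin_dim_subspace0 A2_fin.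
have csQ u v := le_trans (ler_norm _) (cauchy_schwarz ipQE u v).
have csW u v := le_trans (ler_norm _) (cauchy_schwarz ipWE u v).
have csQN u v : - ipQ u v <= `|u| * `|v|.
  by rewrite -dotNr (le_trans (csQ _ _))// normrN.
have bm0 : 0 <= b * m by rewrite mulr_ge0// ltW.
have rhs0 (s t : R) : 0 <= s -> 0 <= t -> 0 <= b * m * (M * (s + t) + eta).
  by move=> s0 t0; apply: mulr_ge0 => //; rewrite addr_ge0// mulr_ge0// addr_ge0.
(* Test with [(phih, 0)]. Since [g] is an arbitrary function, [g 0] stays and is bounded by
   [gle]. *)
have e2le : `|e2| <= b * m * (M * (`|I e1| + `|w|) + eta).
  apply: (norm2_le norm2E) => [|phi phi1].
    exact: rhs0.
  have [phih [Aphi nphi <-//]] := proj1 phi.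
  have := eq phih 0 Aphi A20; have := gle phih 0 Aphi A20.
  rewrite !linear0 normr0 add0r addr0 !sub0r => gl aE.
  have -> : a phih e2 = b * (ipW (I e1) (I phih) - ipW w (I phih) + g 0).
    by move: aE; rewrite mulrN; lra.
  rewrite -mulrA ler_wpM2l ?(ltW b_gt0)//.
  rewrite phi1 mulr1 in nphi.
  have Iphi := le_trans (IM phih) (ler_wpM2l M_ge0 nphi).
  have h1 := le_trans (csW (I e1) (I phih)) (ler_wpM2l (normr_ge0 _) Iphi).
  have h2 : - ipW w (I phih) <= `|w| * (M * m).
    by rewrite -dotNr (le_trans (csW _ _))// normrN ler_wpM2l.
  have h3 := le_trans (le_trans (ler_norm _) gl) (ler_wpM2l eta0 nphi).
  lra.
(* Represent [(e1, .)] as [a . r] with [|r| = |e1|], so that [|e1|^2 = a e1 rh]; test with [(0, rh)]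
   and divide by [|e1|]. *)
have e1le : `|e1| <= b * m * (M * (`|D e2| + `|q|) + eta).
  have [->|e10] := eqVneq e1 0.
    by rewrite normr0 rhs0.
  have ne1 : 0 < `|e1| by rewrite normr_gt0.
  have [r rE nr] := pairing_rep_l ip1E ip2E a_bounded a_nondeg norm2E e1.
  have [rh [Ar nrh rhE]] := proj2 r.
  have := eq 0 rh A10 Ar; have := gle 0 rh A10 Ar.
  rewrite !linear0 ?linear0l normr0 !add0r !addr0 => gl aE.
  rewrite -(ler_pM2l ne1) -expr2 -ip1E rE -rhE//.
  have -> : a e1 rh = b * (ipQ q (D rh) - ipQ (D e2) (D rh) + g rh) by lra.
  rewrite nr in nrh.
  have Drh := le_trans (DM rh) (ler_wpM2l M_ge0 nrh).
  have h1 := le_trans (csQ q (D rh)) (ler_wpM2l (normr_ge0 _) Drh).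
  have h2 := le_trans (csQN (D e2) (D rh)) (ler_wpM2l (normr_ge0 _) Drh).
  have h3 := le_trans (le_trans (ler_norm _) gl) (ler_wpM2l eta0 nrh).
  rewrite [leRHS]mulrC -!mulrA ler_wpM2l ?(ltW b_gt0)//; lra.
(* Test with [(- e1, e2)], cancel [b], and use [(t1 + t2)^2 <= 2 (t1^2 + t2^2)]. *)
have tle : (`|I e1| + `|D e2|) ^+ 2 <=
    2 * (`|q| + `|w|) * (`|I e1| + `|D e2|) + 2 * eta * (`|e1| + `|e2|).
  have NAe1 := fin_dim_subspaceN A1_fin Ae1.
  have := eq (- e1) e2 NAe1 Ae2; have := gle (- e1) e2 NAe1 Ae2.
  rewrite normrN linearN !dotNr linearNl opprK !ipQE !ipWE addrN add0r => gl.
  move/(mulfI (lt0r_neq0 b_gt0)).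
  have := csQ q (D e2); have := csW w (I e1); have := le_trans (ler_norm _) gl.
  move: (normr_ge0 (I e1)) (normr_ge0 (D e2)) (normr_ge0 q) (normr_ge0 w).
  move: `|I e1| `|D e2| `|q| `|w| => t1 t2 n1 n2 t1_0 t2_0 n1_0 n2_0 h1 h2 h3.
  move=> h4; have := sqr_ge0 (t1 - t2); nra.
have t0 : 0 <= `|I e1| + `|D e2| by rewrite addr_ge0.
have dq : 0 <= `|q| + `|w| by rewrite addr_ge0.
set E := `|e1| + `|e2| in tle *.
set t := `|I e1| + `|D e2| in tle t0.
pose s := 2 * (`|q| + `|w| + eta).
have s0 : 0 <= s by rewrite mulr_ge0 ?addr_ge0.
have E0 : 0 <= E by rewrite addr_ge0.
have c0 : 0 <= c by rewrite mulr_ge0 ?addr_ge0.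
have Ele : E <= c * (t + s).
  apply: (@le_trans _ _ (b * m * (M * (t + s) + 2 * eta))).
    apply: le_trans (lerD e1le e2le) _; rewrite -mulrDr ler_wpM2l// /t /s.
    have := mulr_ge0 M_ge0 dq; have := mulr_ge0 M_ge0 eta0; lra.
  rewrite /c -[leRHS]mulrA ler_wpM2l// /s; lra.
have {}tle : t ^+ 2 <= s * t + s * E.
  apply: le_trans tle _; rewrite /s.
  have := mulr_ge0 eta0 t0; have := mulr_ge0 dq E0; lra.
(* Insert [Ele] into [tle]: for [t > s], [c s^2 <= c s t] and one factor [t] cancels. Then
   [E <= c (t + s) <= 2 c (1 + c) s], where [s] carries another factor 2. *)
have tles : t <= (1 + 2 * c) * s.
  have cs := mulr_ge0 c0 s0.
  have [ts|st] := leP t s; first by lra.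
  have tp : 0 < t by lra.
  rewrite -(ler_pM2l tp) -expr2; apply: le_trans tle _.
  have h1 : s * E <= s * (c * (t + s)) by rewrite ler_wpM2l.
  have h2 : c * s * s <= c * s * t by rewrite ler_wpM2l// ltW.
  lra.
apply: le_trans Ele _.
have : c * (t + s) <= c * ((1 + 2 * c) * s + s) by rewrite ler_wpM2l// lerD2r.
rewrite /s; lra.
Qed.

End Discrete.

(** * Normalised vectors, weak convergence and the consistency error *)

Lemma normrZV_le1 (R : realType) (V : normedModType R) (v : V) :
  `| `|v|^-1 *: v| <= 1.
Proof.
have [->|v0] := eqVneq v 0; first by rewrite scaler0 normr0.
by rewrite normrZ normfV normr_id mulVf// normr_eq0.
Qed.

(** The zero vector is normalised to itself since [0^-1 = 0], so projection errors need not be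
    nonzero. *)
Lemma normr_linear_normalized (R : realType) (U V : normedModType R)
    (f : {linear U -> V}) (v : U) : `|f v| = `|v| * `|f (`|v|^-1 *: v)|.
Proof.
have [->|v0] := eqVneq v 0; first by rewrite linear0 !normr0 mul0r.
by rewrite linearZ normrZ normfV normr_id mulVKf// normr_eq0.
Qed.

Lemma weak_cvg0_strong (R : realType) (V : normedModType R) (d : nat -> V) :
  d @ \oo --> (0 : V) -> weak_cvg0 d.
Proof.
move=> d0 l lc; rewrite -(linear0 l).
exact: (cvg_comp _ _ d0 (lc 0)).
Qed.

Lemma norm_continuous_scalar_le (R : realType) (V : normedModType R)
    (l : {scalar V}) : continuous (l : V -> R) ->
  exists K, forall v, `|l v| <= K * `|v|.
Proof.
by move=> lc; exists (opnorm (l : {linear V -> R^o})) => v; exact: opnorm_le.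
Qed.

Lemma alpha_norm_le (R : realType) (Q W V1 V2 : normedModType R)
    (I : {linear V1 -> W}) (D : {linear V2 -> Q}) (alpha M : R)
    (phi : V1 * V2) :
  continuous I -> continuous D -> max_opnorm I D <= M ->
  alpha_norm I alpha D phi <=
    (1 + M ^+ 2 / Num.sqrt alpha) * (`|phi.1| + `|phi.2|).
Proof.
move=> Ic Dc; rewrite /alpha_norm => maxM.
have := maxM; rewrite ge_max => /andP[IM DM].
have I0 := opnorm_ge0 Ic; have M0 : 0 <= M by exact: le_trans IM.
have b0 : 0 <= (Num.sqrt alpha)^-1 by rewrite invr_ge0 sqrtr_ge0.
rewrite mulrDl mul1r lerD ?prod_norm_le//.
apply: (@le_trans _ _ (M / Num.sqrt alpha * (M * (`|phi.1| + `|phi.2|)))).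
  apply: ler_pM; rewrite ?sqrtr_ge0 ?mulr_ge0 ?le_max ?I0 ?ler_wpM2r//.
  apply: le_trans (sqrtr_sqrD_le _ _) _ => //; rewrite mulrDr lerD//.
    by rewrite (le_trans (opnorm_le _ Ic))// ler_wpM2r.
  by rewrite (le_trans (opnorm_le _ Dc))// ler_wpM2r.
by rewrite le_eqVlt; apply/orP; left; apply/eqP; ring.
Qed.

Lemma prod_norm_le_alpha_norm (R : realType) (Q W V1 V2 : normedModType R)
    (I : {linear V1 -> W}) (D : {linear V2 -> Q}) (alpha : R)
    (phi : V1 * V2) :
  continuous I -> prod_norm phi <= alpha_norm I alpha D phi.
Proof.
move=> Ic; rewrite lerDl mulr_ge0 ?sqrtr_ge0// divr_ge0 ?sqrtr_ge0//.
by rewrite le_max opnorm_ge0.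
Qed.

(** The supremum is one-sided, and it bounds its set only once that set is bounded above. The
    constant [k] supplies the bound, as the alpha norm dominates [|phi.2|]; passing to [- phi] gives
    the absolute value. *)
Lemma consistency_error_ge (R : realType) (Q W V1 V2 : completeNormedModType R)
    (ipQ : {dot Q for idfun}) (ipQE : induces_norm ipQ)
    (C : {bilinear Q -> V2 -> R | *%R & *%R}) (Cs : V2 -> Q)
    (I : {linear V1 -> W}) (D : {linear V2 -> Q}) (alpha : R) (z : V2)
    (A1 : set V1) (A2 : set V2) (phi1 : V1) (phi2 : V2) :
  bounded_bilinear C -> continuous I -> continuous D ->
  fin_dim_subspace A1 -> fin_dim_subspace A2 -> A1 phi1 -> A2 phi2 ->
  `|ipQ (D z) (D phi2) - C (Cs z) phi2| <=
    `|consistency_error ipQ C Cs I alpha D z (A1 `*` A2)| *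
    alpha_norm I alpha D (phi1, phi2).
Proof.
move=> [K CK] Ic Dc A1f A2f A1phi A2phi.
pose g v := ipQ (D z) (D v) - C (Cs z) v.
have nge (phi : V1 * V2) := le_trans (prod_norm_ge2 phi)
  (prod_norm_le_alpha_norm D alpha phi Ic).
have an0 (phi : V1 * V2) : 0 <= alpha_norm I alpha D phi.
  exact: le_trans (nge phi).
pose k := `|D z| * opnorm D + `|K| * `|Cs z|.
have k0 : 0 <= k by rewrite addr_ge0 ?mulr_ge0 ?opnorm_ge0.
have gk v : `|g v| <= k * `|v|.
  rewrite (le_trans (ler_normB _ _))// mulrDl lerD//.
    rewrite (le_trans (cauchy_schwarz ipQE _ _))// -mulrA ler_wpM2l//.
    exact: opnorm_le.
  by rewrite (le_trans (CK _ _))// !ler_wpM2r// ler_norm.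
have key psi1 psi2 : A1 psi1 -> A2 psi2 -> g psi2 <=
    `|consistency_error ipQ C Cs I alpha D z (A1 `*` A2)| *
    alpha_norm I alpha D (psi1, psi2).
  move=> A1psi A2psi; have [p0|pn0] := eqVneq (psi1, psi2) 0.
    have -> : psi2 = 0 by case: p0.
    by rewrite /g !linear0 addr0 mulr_ge0.
  have ap : 0 < alpha_norm I alpha D (psi1, psi2).
    apply: lt_le_trans (prod_norm_le_alpha_norm D alpha _ Ic).
    rewrite lt_neqAle prod_norm_ge0 andbT eq_sym; apply: contra pn0 => /eqP p0.
    have := prod_norm_ge1 (psi1, psi2); have := prod_norm_ge2 (psi1, psi2).
    by rewrite p0 !normr_le0 /= => /eqP-> /eqP->.
  rewrite -ler_pdivrMr// (le_trans _ (ler_norm _))//.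
  apply: ub_le_sup; last by exists (psi1, psi2); split => //; apply/eqP.
  exists k => _ [phi [_ /eqP phi0] <-].
  have [->|an] := eqVneq (alpha_norm I alpha D phi) 0.
    by rewrite invr0 mulr0.
  rewrite ler_pdivrMr ?lt_neqAle 1?eq_sym ?an ?an0//.
  by rewrite (le_trans (ler_norm _))// (le_trans (gk _))// ler_wpM2l.
rewrite ler_norml key// andbT lerNl.
have := key (- phi1) (- phi2) (fin_dim_subspaceN A1f A1phi)
  (fin_dim_subspaceN A2f A2phi).
rewrite /g !linearN /= opprK addrC opprB.
by rewrite /alpha_norm /prod_norm /= !linearN !normrN addrC.
Qed.

(** * Asymptotics of the projection errors and the final estimate *)

(* Families depending on the discretization parameter are indexed by n; their
   n-th member is the one belonging to h n. *)
Theorem lemma4p4 (R : realType) (Q W V1 V2 : completeNormedModType R)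
  (ipQ : {dot Q for idfun}) (hQ : induces_norm ipQ)
  (ipW : {dot W for idfun}) (hW : induces_norm ipW)
  (ip1 : {dot V1 for idfun}) (hV1 : induces_norm ip1)
  (ip2 : {dot V2 for idfun}) (hV2 : induces_norm ip2)
  (a : {bilinear V1 -> V2 -> R | *%R & *%R})
  (a_bounded : bounded_bilinear a)
  (a_nondeg : forall v1 : V1, (forall v2 : V2, a v1 v2 = 0) -> v1 = 0)
  (a_inf_sup : (0 < inf_sup a)%E)
  (norm2E : forall v2 : V2,
     `|v2| = sup [set a phi1 v2 | phi1 in [set phi1 : V1 | `|phi1| = 1]])
  (C : {bilinear Q -> V2 -> R | *%R & *%R}) (C_bounded : bounded_bilinear C)
  (I : {linear V1 -> W}) (I_bounded : continuous I)
  (Cs : V2 -> Q) (CsE : forall (q : Q) (v2 : V2), ipQ q (Cs v2) = C q v2)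
  (alpha : R) (alpha_gt0 : 0 < alpha) (ud : W)
  (h : nat -> R) (h_gt0 : forall n, 0 < h n) (h_cvg0 : h @ \oo --> (0 : R))
  (Chs : nat -> {linear V2 -> Q}) (Chs_bounded : forall n, continuous (Chs n))
  (Vh1 : nat -> set V1) (Vh1_fin : forall n, fin_dim_subspace (Vh1 n))
  (Vh2 : nat -> set V2) (Vh2_fin : forall n, fin_dim_subspace (Vh2 n))
  (ah_nondeg : forall n, nondegenerate_on a (Vh1 n) (Vh2 n))
  (Rh1 : nat -> V1 -> V1)
  (Rh1_ritz : forall n, is_ritz_projection a (Vh1 n) (Vh2 n) (Rh1 n))
  (mu : nat -> R)
  (muE : forall n, is_quasi_best_constant (Vh1 n) (Rh1 n) (mu n))
  (x : V1 * V2)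
  (x_sol : forall phi : V1 * V2,
     bform ipQ ipW a I alpha Cs x phi
       = - ((Num.sqrt alpha)^-1 * ipW ud (I phi.1)))
  (xh : nat -> V1 * V2) (xh_in : forall n, (Vh1 n `*` Vh2 n) (xh n))
  (xh_sol : forall n (phi : V1 * V2), (Vh1 n `*` Vh2 n) phi ->
     bform ipQ ipW a I alpha (Chs n) (xh n) phi
       = - ((Num.sqrt alpha)^-1 * ipW ud (I phi.1)))
  (mubar : R) (mubar_ge1 : 1 <= mubar) (mu_le : forall n, mu n <= mubar)
  (Vh_dense : forall v : V1 * V2,
     (fun n => best_error (@prod_norm R V1 V2) (Vh1 n `*` Vh2 n) v)
       @ \oo --> (0 : R))
  (Chs_weak : forall d : nat -> V2, weak_cvg0 d ->
     (fun n => Chs n (d n)) @ \oo --> (0 : Q))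
  (I_compact : compact_operator I)
  (x_consistency : little_o
     (fun n => consistency_error ipQ C Cs I alpha (Chs n) x.2
                 (Vh1 n `*` Vh2 n))
     (fun n => best_error (@prod_norm R V1 V2) (Vh1 n `*` Vh2 n) x)) :
  let M := ereal_sup (range (fun n => (max_opnorm I (Chs n))%:E)) in
  (M < +oo)%E /\
  exists2 o1 : nat -> R, little_o o1 (fun=> 1) &
    forall n, prod_norm (x - xh n) <=
      mu n * (1 + kappa alpha (fine M) mubar / Num.sqrt alpha * o1 n) *
      best_error (@prod_norm R V1 V2) (Vh1 n `*` Vh2 n) x.
Proof.
have Ic := I_bounded.
(* Strongly null sequences are weakly null, so assumption (iii) bounds the operators [Chs n]
   uniformly; this makes [M] finite. *)
have [B BP] : exists B, forall n, opnorm (Chs n) <= B.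
  by apply: opnorm_bounded => // d /weak_cvg0_strong/Chs_weak.
pose M0 := Num.max (opnorm I) B.
have M0P n : max_opnorm I (Chs n) <= M0.
  by rewrite ge_max !le_max lexx BP orbT.
have M0ge0 : 0 <= M0 by rewrite le_max opnorm_ge0.
have IM v : `|I v| <= M0 * `|v|.
  by rewrite (le_trans (opnorm_le _ Ic))// ler_wpM2r// le_max lexx.
have DM n v : `|Chs n v| <= M0 * `|v|.
  rewrite (le_trans (opnorm_le _ (@Chs_bounded n)))// ler_wpM2r//.
  by rewrite le_max BP orbT.
move=> M.
have Mle : (M <= M0%:E)%E by apply: ge_ereal_sup => _ [n _ <-]; rewrite lee_fin.
have Mlt : (M < +oo)%E by apply: le_lt_trans Mle (ltry _).
have Mge : (0 <= M)%E.
  apply: (@le_trans _ _ (max_opnorm I (Chs 0))%:E).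
    by rewrite lee_fin le_max opnorm_ge0.
  by apply: ereal_sup_ubound; exists 0%N.
split => //.
have mub0 : 0 <= mubar by exact: le_trans mubar_ge1.
have sa : 0 < Num.sqrt alpha by rewrite sqrtr_gt0.
pose b := (Num.sqrt alpha)^-1; have b0 : 0 < b by rewrite invr_gt0.
(* The constant [kappa] plays no role beyond its positivity: it is absorbed in
   [o1] below. *)
pose kap := kappa alpha (fine M) mubar.
have kap0 : 0 < kap.
  have fM : 0 <= fine M by rewrite fine_ge0.
  rewrite /kap /kappa; set L := fine M / Num.sqrt alpha.
  have L0 : 0 <= L by rewrite divr_ge0 ?sqrtr_ge0.
  apply: mulr_gt0; first by apply: divr_gt0; lra.
  have := mulr_ge0 (mulr_ge0 fM mub0) L0.
  have := mulr_ge0 fM mub0; rewrite -[2 * _ / _]mulrA -/L; lra.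
have /choice[z zP] n : exists w, Vh2 n w /\ forall phi1, Vh1 n phi1 ->
    a phi1 w = a phi1 x.2.
  by have [w ? ?] := ex_ritz_projection_r x.2 (Vh1_fin n) (Vh2_fin n)
    (ah_nondeg n).1; exists w.
pose best n := best_error (@prod_norm R V1 V2) (Vh1 n `*` Vh2 n) x.
pose d1 n := x.1 - Rh1 n x.1.
pose d2 n := x.2 - z n.
have mu1 n : 1 <= mu n := (muE n).1.1.
have mu0 n : 0 <= mu n := le_trans ler01 (mu1 n).
have ne n : (Vh1 n `*` Vh2 n) !=set0 by exists (xh n); exact: xh_in.
have d1v n v : Vh1 n v -> `|d1 n| <= mu n * `|x.1 - v|.
  move=> v1; rewrite (le_trans ((muE n).1.2 _))// ler_wpM2l//.
  exact: best_error_le.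
have d2v n v : Vh2 n v -> `|d2 n| <= mu n * `|x.2 - v|.
  move=> v2; have [z2 zE] := zP n.
  exact: (quasi_best_adjoint a_bounded norm2E (Vh1_fin n) (Rh1_ritz n) (muE n).1).
have ritz_best n : prod_norm ((d1 n, d2 n) : V1 * V2) <= mu n * best n.
  rewrite -ler_pdivrMl ?(lt_le_trans ltr01)//; apply: best_error_ge => // v [v1 v2].
  rewrite ler_pdivrMl ?(lt_le_trans ltr01)//.
  rewrite -[mu n]ger0_norm// -sqrtr_sqr -sqrtrM ?sqr_ge0// mulrDr -!exprMn.
  rewrite ler_wsqrtr// lerD// lerXn2r ?nnegrE ?mulr_ge0//.
    exact: d1v.
  exact: d2v.
have best0 n : 0 <= best n.
  by apply: best_error_ge => // v _; exact: prod_norm_ge0.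
pose w n := `|d1 n|^-1 *: d1 n.
pose y n := `|d2 n|^-1 *: d2 n.
have yle1 n : `|y n| <= 1 by exact: normrZV_le1.
have wle1 n : `|w n| <= 1 by exact: normrZV_le1.
(* Write [l = a s]. Since [a v.1 (y n) = 0] on [Vh1 n], [|l (y n)|] is at most the best error of
   [(s, 0)], which density sends to 0. *)
have yweak : weak_cvg0 y.
  move=> l lc; have [K lK] := norm_continuous_scalar_le lc.
  have [r rE] := riesz hV2 (fun t u v => linearP l t u v) lK.
  have [s sE] := pairing_rep_r hV1 hV2 a_bounded norm2E r.
  apply/norm_cvg0P; apply: (squeeze_cvgr _ (cvg_cst 0) (Vh_dense (s, 0))).
  apply: nearW => n; rewrite normr_ge0 /=; apply: best_error_ge => // v [v1 v2].
  have -> : l (y n) = a (s - v.1) (y n).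
    rewrite rE sE linearBl /= [X in _ - X](_ : _ = 0) ?subr0//.
    by rewrite pairingZr linearBr /= (zP n).2// subrr mulr0.
  rewrite (le_trans (norm_pairing_le a_bounded norm2E _ _))//.
  apply: le_trans (prod_norm_ge1 ((s, 0) - v)).
  exact: ler_piMr.
have Chy : (fun n => Chs n (y n)) @ \oo --> (0 : Q) by exact: Chs_weak.
(* The same argument with the roles exchanged: [(q, I .)] is [a . r], and [w n] is annihilated by
   [Vh2 n]. *)
have Iw : (fun n => I (w n)) @ \oo --> (0 : W).
  apply: (compact_operator_cvg0 hW I_compact) => // q.
  have [s sE] : exists s, forall v, ipW q (I v) = ip1 s v.
    apply: (riesz hV1 (K := `|q| * M0)) => [t u v|v].
      by rewrite linearP dotDr dotZr.
    by rewrite (le_trans (cauchy_schwarz hW _ _))// -mulrA ler_wpM2l.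
  have [r rE _] := pairing_rep_l hV1 hV2 a_bounded a_nondeg norm2E s.
  apply/norm_cvg0P; apply: (squeeze_cvgr _ (cvg_cst 0) (Vh_dense (0, r))).
  apply: nearW => n; rewrite normr_ge0 /=; apply: best_error_ge => // v [v1 v2].
  have -> : ipW q (I (w n)) = a (w n) (r - v.2).
    rewrite sE rE linearBr /= [X in _ - X](_ : _ = 0) ?subr0//.
    by rewrite pairingZl linearBl /= (Rh1_ritz n _).2// subrr mulr0.
  rewrite (le_trans (norm_pairing_le a_bounded norm2E _ _))// mulrC.
  apply: le_trans (prod_norm_ge2 ((0, r) - v)).
  exact: ler_piMr.
have [eps eps0 epsP] := x_consistency.
pose k := 1 + M0 ^+ 2 / Num.sqrt alpha.
have k0 : 0 <= k by rewrite addr_ge0 ?divr_ge0 ?exprn_ge0 ?sqrtr_ge0.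
(* Size of the discrete data relative to the best error. The absolute value of [eps n] is taken
   because its sign is not prescribed. *)
pose sig n := mubar * (`|Chs n (y n)| + `|I (w n)|) + `|eps n| * k.
have sig_ge0 n : 0 <= sig n.
  by apply: addr_ge0; apply: mulr_ge0 => //; exact: addr_ge0.
have sig0 : sig @ \oo --> (0 : R).
  rewrite -[0 in X in _ --> X](_ : mubar * (0 + 0) + 0 * k = 0); last by ring.
  apply: cvgD; apply: cvgM; rewrite ?cvg_cst//; last 2 first.
  - by apply/norm_cvg0P; exact: eps0.
  - exact: cvg_cst.
  - exact: cvg_cst.
  by apply: cvgD; apply/norm_cvg0P.
(* The constant of [discrete_stability] for [m = 1 + mubar], a bound for the Ritz projections by the
   triangle inequality. *)
pose c := b * (1 + mubar) * (M0 + 2).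
have c0 : 0 <= c.
  by apply: mulr_ge0; [apply: mulr_ge0; [exact: ltW|]|]; exact: addr_ge0.
pose K := 4 * c * (1 + c).
have K0 : 0 <= K by apply: mulr_ge0; [exact: mulr_ge0|exact: addr_ge0].
have main n : prod_norm (x - xh n) <= mu n * (1 + K * sig n) * best n.
  have [z2 zE] := zP n; have [Rx1 RxE] := Rh1_ritz n x.1.
  have [xh1 xh2] := xh_in n.
  pose e : V1 * V2 := (Rh1 n x.1 - (xh n).1, z n - (xh n).2).
  have ele : `|e.1| + `|e.2| <= K * (sig n * best n).
    pose g v := ipQ (Chs n x.2) (Chs n v) - C (Cs x.2) v.
    pose eta := `|eps n| * k * best n.
    have d1b : `|d1 n| <= mubar * best n.
      rewrite (le_trans (prod_norm_ge1 ((d1 n, d2 n) : V1 * V2)))//.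
      by rewrite (le_trans (ritz_best n))// ler_wpM2r.
    have d2b : `|d2 n| <= mubar * best n.
      rewrite (le_trans (prod_norm_ge2 ((d1 n, d2 n) : V1 * V2)))//.
      by rewrite (le_trans (ritz_best n))// ler_wpM2r.
    apply: (@le_trans _ _
        (K * (`|Chs n (- d2 n)| + `|I (- d1 n)| + eta))); last first.
      rewrite ler_wpM2l// /sig [leRHS]mulrDl lerD// mulrAC mulrDr.
      rewrite !linearN !normrN normr_linear_normalized -/(y n).
      rewrite [X in _ + X <= _]normr_linear_normalized -/(w n).
      by rewrite lerD// ler_wpM2r.
    apply: (discrete_stability hV1 hV2 a_bounded a_nondeg norm2E (Vh1_fin n)
      (Vh2_fin n) hQ hW b0 _ M0ge0 IM (DM n) _ _ (g := g)).
    - by rewrite addr_ge0// (le_trans ler01).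
    - move=> phi; have [Rphi RphiE] := Rh1_ritz n phi.
      exists (Rh1 n phi); split => //.
      have : `|Rh1 n phi| <= `|phi| + `|phi - Rh1 n phi|.
        by rewrite -[X in `|X| <= _](subKr phi) ler_normB.
      move=> /le_trans; apply; rewrite mulrDl mul1r lerD2l.
      rewrite (le_trans ((muE n).1.2 _))// ler_pM//.
        by apply: best_error_ge => //; exists (Rh1 n phi).
      rewrite -[X in _ <= `|X|]subr0; apply: best_error_le => //.
      exact: fin_dim_subspace0.
    - move=> psi.
      have [wh w2 wE] := ex_ritz_projection_r psi (Vh1_fin n) (Vh2_fin n)
        (ah_nondeg n).1.
      exists wh; split => //.
      have : `|wh| <= `|psi| + `|psi - wh|.
        by rewrite -[X in `|X| <= _](subKr psi) ler_normB.
      move=> /le_trans; apply; rewrite mulrDl mul1r lerD2l.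
      have := quasi_best_adjoint a_bounded norm2E (Vh1_fin n) (Rh1_ritz n)
        (muE n).1 w2 wE (fin_dim_subspace0 (Vh2_fin n)).
      by rewrite subr0 => /le_trans; apply; rewrite ler_wpM2r.
    - exact: fin_dim_subspaceB.
    - exact: fin_dim_subspaceB.
    - by rewrite /eta !mulr_ge0.
    - move=> phi1 phi2 A1phi A2phi.
      apply: le_trans (consistency_error_ge hQ Cs alpha x.2 C_bounded Ic
        (@Chs_bounded n) (Vh1_fin n) (Vh2_fin n) A1phi A2phi) _.
      rewrite (_ : eta * _ = `|eps n| * best n * (k * (`|phi1| + `|phi2|))).
        2: by rewrite /eta; ring.
      apply: ler_pM => //.
      + exact: le_trans (prod_norm_ge0 _) (prod_norm_le_alpha_norm _ _ _ Ic).
      + apply: le_trans (epsP n) _.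
        by apply: ler_wpM2r; [exact: best0|exact: ler_norm].
      + exact: (alpha_norm_le alpha (phi1, phi2) Ic (@Chs_bounded n)).
    (* Subtract the two variational equations. Since [e = x - xh n - d], the projection errors enter
       only through [I] and [Chs n]; exchanging [Cs] for [Chs n] leaves [g]. *)
    - move=> phi1 phi2 A1phi A2phi.
      have := xh_sol n (phi1, phi2) (conj A1phi A2phi).
      have := x_sol (phi1, phi2).
      rewrite /bform /= CsE => <- /eqP; rewrite -subr_eq0 => /eqP.
      have -> : a e.1 phi2 = a x.1 phi2 - a (xh n).1 phi2.
        by rewrite linearBl /= RxE.
      have -> : a phi1 e.2 = a phi1 x.2 - a phi1 (xh n).2.
        by rewrite linearBr /= zE.
      rewrite /e /d1 /d2 /g /= !opprB !(linearB I) !(linearB (Chs n)) /=.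
      rewrite !dotBl -/b; lra.
  rewrite (_ : x - xh n = (d1 n, d2 n) + e); last first.
    rewrite [x]surjective_pairing [xh n]surjective_pairing.
    by congr pair; rewrite /= addrA subrK.
  apply: le_trans (ler_prod_normD _ _) _.
  have := le_trans (prod_norm_le e) ele; have := ritz_best n.
  (* As [mu n >= 1], the bound of [e] can be put under the factor [mu n]. *)
  have : K * (sig n * best n) <= mu n * (K * (sig n * best n)).
    by apply: ler_peMl => //; apply: mulr_ge0 => //; exact: mulr_ge0.
  lra.
(* Scaled so that multiplication by [kap / Num.sqrt alpha] returns [K * sig n]. *)
exists (fun n => K * sig n * Num.sqrt alpha / kap).
  exists (fun n => K * sig n * Num.sqrt alpha / kap) => [|n]; last first.
    rewrite mulr1 ger0_norm//; apply: divr_ge0 (ltW kap0).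
    by apply: mulr_ge0 (ltW sa); exact: mulr_ge0.
  rewrite -[0 in X in _ --> X](_ : K * 0 * Num.sqrt alpha / kap = 0); last by ring.
  apply: cvgM; last exact: cvg_cst.
  apply: cvgM; last exact: cvg_cst.
  by apply: cvgM => //; exact: cvg_cst.
move=> n; apply: le_trans (main n) _; rewrite le_eqVlt; apply/orP; left.
apply/eqP; rewrite -/kap /best; congr (_ * (1 + _) * _); field.
by rewrite !gt_eqF.
Qed.
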